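(* Any homogeneous quasi-homomorphism $\varphi\colon B_\infty\rightarrow\mathbb{R}$ on the infinite braid group $B_\infty$ is a homomorphism.
   Context: Let $B_n$ be the Artin braid group on $n$ strands. Adding a strand defines an injective stabilization homomorphism $B_n\rightarrow B_{n+1}$ (sending each standard generator $\sigma_i$ to $\sigma_i$). The braid group on infinitely many strands is $B_\infty=\bigcup_nB_n$. A map $f\colon\Gamma\rightarrow\mathbb{R}$ on a group $\Gamma$ is a quasi-homomorphism if there is a constant $D$ such that $|f(xy)-f(x)-f(y)|\leq D$ for all $x,y\in\Gamma$. It is homogeneous if $f(g^n)=nf(g)$ for all $g\in\Gamma$ and all $n\in\mathbb{Z}$. *)

(* Defs.v *)
From HB Require Import structures.
From mathcomp Require Import all_boot all_order all_algebra.
From mathcomp Require Import boolp reals.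

Set Implicit Arguments.
Unset Strict Implicit.
Unset Printing Implicit Defensive.

Import GRing.Theory Num.Theory.

Local Open Scope group_scope.
Local Open Scope quotient_scope.

(* The letter (i, false) is the Artin generator conventionally written
   sigma_(i+1), and (i, true) is its inverse. *)
Definition braid_word (n : nat) := seq ('I_n.-1 * bool).

Inductive braid_eq (n : nat) : braid_word n -> braid_word n -> Prop :=
| braid_eq_refl u : braid_eq u u
| braid_eq_sym u v : braid_eq u v -> braid_eq v u
| braid_eq_trans u v w : braid_eq u v -> braid_eq v w -> braid_eq u w
| braid_eq_cat u u' v v' :
    braid_eq u u' -> braid_eq v v' -> braid_eq (u ++ v) (u' ++ v')
| braid_eq_cancel i b : braid_eq [:: (i, b); (i, ~~ b)] [::]
| braid_eq_far (i j : 'I_n.-1) : i.+1 < j ->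
    braid_eq [:: (i, false); (j, false)] [:: (j, false); (i, false)]
| braid_eq_braid (i j : 'I_n.-1) : j = i.+1 :> nat ->
    braid_eq [:: (i, false); (j, false); (i, false)]
             [:: (j, false); (i, false); (j, false)].

Section BraidGroup.
Variable n : nat.
Implicit Types u v w : braid_word n.

Definition braid_eqb u v : bool := `[< braid_eq u v >].

Lemma braid_eqb_refl : reflexive braid_eqb.
Proof. by move=> u; apply/asboolP; apply: braid_eq_refl. Qed.

Lemma braid_eqb_sym : symmetric braid_eqb.
Proof. by move=> u v; apply/asboolP/asboolP; apply: braid_eq_sym. Qed.

Lemma braid_eqb_trans : transitive braid_eqb.
Proof.
by move=> v u w /asboolP uv /asboolP vw; apply/asboolP/(braid_eq_trans uv vw).
Qed.

Canonical braid_equiv :=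
  EquivRel braid_eqb braid_eqb_refl braid_eqb_sym braid_eqb_trans.

Definition braid_group := {eq_quot braid_equiv}.

HB.instance Definition _ := Choice.on braid_group.

Definition braid_class u : braid_group := \pi_{eq_quot braid_equiv} u.

Lemma braid_classP u v : braid_class u = braid_class v <-> braid_eq u v.
Proof.
split=> [/eqP|uv]; first by rewrite piE => /asboolP.
by apply/eqP; rewrite piE; apply/asboolP.
Qed.

Lemma braid_class_repr (x : braid_group) : braid_class (repr x) = x.
Proof. exact: reprK. Qed.

Lemma repr_braid_class u : braid_eq (repr (braid_class u)) u.
Proof. by apply/braid_classP; rewrite braid_class_repr. Qed.

Definition braid_word_inv u : braid_word n := rev [seq (a.1, ~~ a.2) | a <- u].

Definition braid_one : braid_group := braid_class [::].
Definition braid_mul (x y : braid_group) : braid_group :=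
  braid_class (repr x ++ repr y).
Definition braid_inv (x : braid_group) : braid_group :=
  braid_class (braid_word_inv (repr x)).

Lemma braid_mul_class u v :
  braid_mul (braid_class u) (braid_class v) = braid_class (u ++ v).
Proof.
by apply/braid_classP; apply: braid_eq_cat; apply: repr_braid_class.
Qed.

Lemma braid_word_mulV u : braid_eq (u ++ braid_word_inv u) [::].
Proof.
elim: u => [|[i b] u IHu]; first exact: braid_eq_refl.
rewrite /braid_word_inv map_cons rev_cons -cats1 cat_cons catA -/(braid_word_inv u).
apply: braid_eq_trans (braid_eq_cancel i b).
apply: (@braid_eq_cat _ [:: (i, b)] [:: (i, b)]); first exact: braid_eq_refl.
apply: (@braid_eq_cat _ _ [::] [:: (i, ~~ b)] [:: (i, ~~ b)]) => //.
exact: braid_eq_refl.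
Qed.

Lemma braid_word_invK : involutive braid_word_inv.
Proof.
move=> u; rewrite /braid_word_inv map_rev revK -map_comp map_id_in //.
by move=> [i b] _ /=; rewrite negbK.
Qed.

Lemma braid_mulA : associative braid_mul.
Proof.
move=> x y z; rewrite -[x]braid_class_repr -[y]braid_class_repr.
by rewrite -[z]braid_class_repr !braid_mul_class catA.
Qed.

Lemma braid_mul1 : left_id braid_one braid_mul.
Proof. by move=> x; rewrite -[x]braid_class_repr braid_mul_class. Qed.

Lemma braid_mulr1 : right_id braid_one braid_mul.
Proof. by move=> x; rewrite -[x]braid_class_repr braid_mul_class cats0. Qed.

Lemma braid_mulV : right_inverse braid_one braid_inv braid_mul.
Proof.
move=> x; rewrite -{1}[x]braid_class_repr braid_mul_class.
by apply/braid_classP/braid_word_mulV.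
Qed.

Lemma braid_mulVl : left_inverse braid_one braid_inv braid_mul.
Proof.
move=> x; rewrite -{2}[x]braid_class_repr braid_mul_class.
by apply/braid_classP; rewrite -{2}[repr x]braid_word_invK; apply: braid_word_mulV.
Qed.

HB.instance Definition _ := isGroup.Build braid_group
  braid_mulA braid_mul1 braid_mulr1 braid_mulVl braid_mulV.

Lemma braid_classM u v : braid_class u * braid_class v = braid_class (u ++ v).
Proof. exact: braid_mul_class. Qed.

Lemma braid_class1 : braid_class [::] = 1.
Proof. by []. Qed.

End BraidGroup.

Section Stabilization.

Lemma leq_pred_mono m n : m <= n -> m.-1 <= n.-1.
Proof. by rewrite -!subn1; apply: leq_sub2r. Qed.

Definition stab_word m n (le_mn : m <= n) (u : braid_word m) : braid_word n :=
  [seq (widen_ord (leq_pred_mono le_mn) a.1, a.2) | a <- u].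

(* The composite of the n - m one-strand stabilizations from m to n strands. *)
Definition stab m n (le_mn : m <= n) (x : braid_group m) : braid_group n :=
  braid_class (stab_word le_mn (repr x)).

Lemma stab_word_eq m n (le_mn : m <= n) u v :
  braid_eq u v -> braid_eq (stab_word le_mn u) (stab_word le_mn v).
Proof.
elim=> {u v} [u|u v _|u v w _ + _|u u' v v' _ + _|i b|i j ij|i j ij].
- exact: braid_eq_refl.
- exact: braid_eq_sym.
- exact: braid_eq_trans.
- by rewrite /stab_word !map_cat; apply: braid_eq_cat.
- exact: braid_eq_cancel.
- exact: braid_eq_far.
- exact: braid_eq_braid.
Qed.

Lemma stab_class m n (le_mn : m <= n) u :
  stab le_mn (braid_class u) = braid_class (stab_word le_mn u).
Proof. by apply/braid_classP/stab_word_eq/repr_braid_class. Qed.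

Lemma stabM m n (le_mn : m <= n) : {morph stab le_mn : x y / x * y}.
Proof.
move=> x y; rewrite -[x]braid_class_repr -[y]braid_class_repr.
by rewrite braid_classM !stab_class braid_classM /stab_word map_cat.
Qed.

Lemma stab1 m n (le_mn : m <= n) : stab le_mn 1 = 1.
Proof. by rewrite -!braid_class1 stab_class. Qed.

HB.instance Definition _ m n (le_mn : m <= n) :=
  isUMagmaMorphism.Build (braid_group m) (braid_group n) (stab le_mn)
    (stab1 le_mn, stabM le_mn).

Lemma stab_comp m n p (le_mn : m <= n) (le_np : n <= p) (le_mp : m <= p) x :
  stab le_np (stab le_mn x) = stab le_mp x.
Proof.
rewrite -[x]braid_class_repr !stab_class /stab_word -map_comp.
congr (braid_class _); apply: eq_map => -[i b] /=.
by congr (_, _); apply: val_inj.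
Qed.

Lemma stab_id n (le_nn : n <= n) x : stab le_nn x = x.
Proof.
rewrite -[x in RHS]braid_class_repr; congr (braid_class _).
by rewrite /stab_word map_id_in // => -[i b] _; congr (_, _); apply: val_inj.
Qed.

End Stabilization.

(* B_infty is the union of the groups B_n along the stabilizations, that is,
   their direct limit: braids on m and on n strands are identified when they
   agree after adding strands to both. *)
Section InfiniteBraidGroup.

Definition fin_braid := {n : nat & braid_group n}.

Definition braid_inf_eq (x y : fin_braid) : Prop :=
  exists p (le_xp : tag x <= p) (le_yp : tag y <= p),
    stab le_xp (tagged x) = stab le_yp (tagged y).

Definition braid_inf_eqb (x y : fin_braid) : bool := `[< braid_inf_eq x y >].

Lemma braid_inf_eqb_refl : reflexive braid_inf_eqb.
Proof.
by move=> x; apply/asboolP; exists (tag x), (leqnn _), (leqnn _).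
Qed.

Lemma braid_inf_eqb_sym : symmetric braid_inf_eqb.
Proof.
by move=> x y; apply/asboolP/asboolP => -[p [lex [ley eqxy]]]; exists p, ley, lex.
Qed.

Lemma braid_inf_eqb_trans : transitive braid_inf_eqb.
Proof.
move=> y x z /asboolP[p [xp [yp exy]]] /asboolP[q [yq [zq eyz]]].
have pm := leq_maxl p q; have qm := leq_maxr p q.
apply/asboolP; exists (maxn p q), (leq_trans xp pm), (leq_trans zq qm).
rewrite -(stab_comp xp pm) exy (stab_comp _ _ (leq_trans yq qm)).
by rewrite -(stab_comp yq qm) eyz (stab_comp _ _ (leq_trans zq qm)).
Qed.

Canonical braid_inf_equiv :=
  EquivRel braid_inf_eqb braid_inf_eqb_refl braid_inf_eqb_sym
    braid_inf_eqb_trans.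

Definition braid_inf := {eq_quot braid_inf_equiv}.

HB.instance Definition _ := Choice.on braid_inf.

(* The canonical map from B_n to B_infty. *)
Definition braid_incl n (x : braid_group n) : braid_inf :=
  \pi_{eq_quot braid_inf_equiv} (Tagged braid_group x).

Lemma braid_inclP m n (x : braid_group m) (y : braid_group n) :
  braid_incl x = braid_incl y <->
  exists p (le_mp : m <= p) (le_np : n <= p), stab le_mp x = stab le_np y.
Proof.
split=> [/eqP|xy]; first by rewrite piE => /asboolP.
by apply/eqP; rewrite piE; apply/asboolP.
Qed.

Lemma braid_incl_stab m n (le_mn : m <= n) x :
  braid_incl (stab le_mn x) = braid_incl x.
Proof. by apply/braid_inclP; exists n, (leqnn n), le_mn; rewrite stab_id. Qed.

Lemma braid_incl_repr (a : braid_inf) : braid_incl (tagged (repr a)) = a.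
Proof. by rewrite /braid_incl -[RHS]reprK; case: (repr a). Qed.

Lemma braid_incl_surj (a : braid_inf) :
  exists n (x : braid_group n), a = braid_incl x.
Proof. by exists _, (tagged (repr a)); rewrite braid_incl_repr. Qed.

Definition braid_inf_one : braid_inf := braid_incl (1 : braid_group 0).

Definition braid_inf_mul (a b : braid_inf) : braid_inf :=
  let x := repr a in let y := repr b in
  braid_incl (stab (leq_maxl (tag x) (tag y)) (tagged x) *
              stab (leq_maxr (tag x) (tag y)) (tagged y)).

Definition braid_inf_inv (a : braid_inf) : braid_inf :=
  braid_incl (tagged (repr a))^-1.

Lemma braid_inf_mul_incl n (x y : braid_group n) :
  braid_inf_mul (braid_incl x) (braid_incl y) = braid_incl (x * y).
Proof.
rewrite /braid_inf_mul.
move: (repr (braid_incl x)) (repr (braid_incl y)) (braid_incl_repr (braid_incl x))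
  (braid_incl_repr (braid_incl y)) => [k u] [l v] /=.
move=> /braid_inclP[p [kp [np eux]]] /braid_inclP[q [lq [nq evy]]].
have pm := leq_maxl (maxn k l) (maxn p q).
have [pr qr] : p <= maxn (maxn k l) (maxn p q) /\ q <= maxn (maxn k l) (maxn p q).
  by split; apply: leq_trans (leq_maxr _ _); rewrite leq_max leqnn ?orbT.
apply/braid_inclP; exists (maxn (maxn k l) (maxn p q)), pm, (leq_trans np pr).
rewrite !stabM; congr (_ * _).
  rewrite (stab_comp _ _ (leq_trans kp pr)) -(stab_comp kp pr) eux.
  exact: stab_comp.
rewrite (stab_comp _ _ (leq_trans lq qr)) -(stab_comp lq qr) evy.
exact: stab_comp.
Qed.

Lemma braid_inf_inv_incl n (x : braid_group n) :
  braid_inf_inv (braid_incl x) = braid_incl x^-1.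
Proof.
rewrite /braid_inf_inv.
move: (repr _) (braid_incl_repr (braid_incl x)) => [k u] /=.
move=> /braid_inclP[p [kp [np eux]]].
by apply/braid_inclP; exists p, kp, np; rewrite !gmulfV /= eux.
Qed.

Lemma braid_inf_common2 (a b : braid_inf) :
  exists n (x y : braid_group n), a = braid_incl x /\ b = braid_incl y.
Proof.
have [m [x ->]] := braid_incl_surj a; have [n [y ->]] := braid_incl_surj b.
exists (maxn m n), (stab (leq_maxl _ _) x), (stab (leq_maxr _ _) y).
by rewrite !braid_incl_stab.
Qed.

Lemma braid_inf_one_incl n : braid_inf_one = braid_incl (1 : braid_group n).
Proof. by rewrite -(stab1 (leq0n n)) braid_incl_stab. Qed.

Lemma braid_inf_mulA : associative braid_inf_mul.
Proof.
move=> a b c; have [m [x [y [-> ->]]]] := braid_inf_common2 a b.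
have [n [z ->]] := braid_incl_surj c.
rewrite -(braid_incl_stab (leq_maxl m n) x) -(braid_incl_stab (leq_maxl m n) y).
by rewrite -(braid_incl_stab (leq_maxr m n) z) !braid_inf_mul_incl mulgA.
Qed.

Lemma braid_inf_mul1 : left_id braid_inf_one braid_inf_mul.
Proof.
move=> a; have [n [x ->]] := braid_incl_surj a.
by rewrite (braid_inf_one_incl n) braid_inf_mul_incl mul1g.
Qed.

Lemma braid_inf_mulr1 : right_id braid_inf_one braid_inf_mul.
Proof.
move=> a; have [n [x ->]] := braid_incl_surj a.
by rewrite (braid_inf_one_incl n) braid_inf_mul_incl mulg1.
Qed.

Lemma braid_inf_mulVl : left_inverse braid_inf_one braid_inf_inv braid_inf_mul.
Proof.
move=> a; have [n [x ->]] := braid_incl_surj a.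
by rewrite braid_inf_inv_incl braid_inf_mul_incl mulVg -braid_inf_one_incl.
Qed.

Lemma braid_inf_mulV : right_inverse braid_inf_one braid_inf_inv braid_inf_mul.
Proof.
move=> a; have [n [x ->]] := braid_incl_surj a.
by rewrite braid_inf_inv_incl braid_inf_mul_incl mulgV -braid_inf_one_incl.
Qed.

HB.instance Definition _ := isGroup.Build braid_inf
  braid_inf_mulA braid_inf_mul1 braid_inf_mulr1 braid_inf_mulVl braid_inf_mulV.

Lemma braid_inclM n : {morph @braid_incl n : x y / x * y}.
Proof. by move=> x y; rewrite -braid_inf_mul_incl. Qed.

Lemma braid_incl1 n : @braid_incl n 1 = 1.
Proof. by rewrite -braid_inf_one_incl. Qed.

HB.instance Definition _ n :=
  isUMagmaMorphism.Build (braid_group n) braid_inf (@braid_incl n)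
    (@braid_incl1 n, @braid_inclM n).

End InfiniteBraidGroup.

Section QuasiHomomorphisms.
Variables (G : groupType) (R : realType).
Implicit Type f : G -> R.

Local Open Scope ring_scope.

Definition zexpg (g : G) (n : int) : G :=
  match n with
  | Posz k => (g ^+ k)%g
  | Negz k => (g ^- k.+1)%g
  end.

Definition quasi_homomorphism f : Prop :=
  exists D : R, forall x y : G, `|f (x * y)%g - f x - f y| <= D.

Definition homogeneous f : Prop :=
  forall (g : G) (n : int), f (zexpg g n) = n%:~R * f g.

Definition additive_homomorphism f : Prop :=
  forall x y : G, f (x * y)%g = f x + f y.

End QuasiHomomorphisms.

(* Main.v *)
Require Import Defs.
From mathcomp Require Import all_boot all_order all_algebra.
From mathcomp Require Import reals lra.

(** The proof rests on displacement: any two elements x and y of the infinite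
braid group lie in some B_n, and some t conjugates B_n onto the group of
braids on the next n strands, whose elements commute with those of B_n
([braid_inf_displaceable]).

A homogeneous quasi-homomorphism f is invariant under conjugation
([homogeneous_conjg]) and additive on commuting pairs
([homogeneous_commute]).  Hence, with X = x * x^t and Y = y * y^t,
one has f X = 2 * f x and f Y = 2 * f y, and X * Y = (x * y) * (x * y)^t gives
f (X * Y) = 2 * f (x * y).  So the defect f (x * y) - f x - f y doubles when
(x, y) is replaced by (X, Y).  Iterating, a nonzero defect would grow beyond
every bound, which is impossible for a quasi-homomorphism
([displaceable_additive]).

The conjugator t is an iterate of the descending product
sigma_m * ... * sigma_1: by the braid relation, conjugation by this element
maps sigma_i to sigma_(i+1) for i < m ([descending_conj]). *)

Set Implicit Arguments.
Unset Strict Implicit.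
Unset Printing Implicit Defensive.

Import Order.TTheory GRing.Theory Num.Theory.

Local Open Scope group_scope.

(** * Quasi-homomorphisms on groups with commuting conjugates *)

Section CommutingConjugates.
Variables (G : groupType) (R : realType).
Implicit Types (f : G -> R) (x y t : G).

(** The defect of a quasi-homomorphism only involves two elements at a time,
so displacement is asked of pairs; commutation on x and y makes the whole
subgroup that they generate commute with its conjugate by t. *)
Definition displaceable : Prop :=
  forall x y, exists t, [/\ commute x (x ^ t), commute x (y ^ t),
                            commute y (x ^ t) & commute y (y ^ t)].

Lemma eq0_of_bounded_mulrn (a C : R) :
  (forall n : nat, `|a| *+ n <= C)%R -> a = 0%R.
Proof.
move=> bound; apply/eqP; rewrite -normr_eq0 eq_le normr_ge0 andbT leNgt.
apply/negP => a_gt0; have C_ge0 : (0 <= C)%R by have := bound 0.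
have /archi_boundP : (0 <= C / `|a|)%R by rewrite divr_ge0.
by rewrite ltr_pdivrMr // mulr_natl ltNge bound.
Qed.

Lemma homogeneousX f x n : homogeneous f -> f (x ^+ n) = (f x *+ n)%R.
Proof. by move=> /(_ x (Posz n)) /= ->; rewrite mulr_natl. Qed.

(** The defects of the pairs (x ^+ n, y ^+ n) are bounded, but grow
linearly in n since (x * y) ^+ n = x ^+ n * y ^+ n. *)
Lemma homogeneous_commute f x y :
  quasi_homomorphism f -> homogeneous f -> commute x y ->
  f (x * y) = (f x + f y)%R.
Proof.
move=> [D fD] fH cxy; apply/eqP; rewrite -subr_eq0 opprD addrA; apply/eqP.
apply: (@eq0_of_bounded_mulrn _ D) => n.
by rewrite -normrMn !mulrnBl -!homogeneousX // expgMn.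
Qed.

(** Conjugation by y changes f by a bounded amount, whereas a change at x
is multiplied by n at x ^+ n. *)
Lemma homogeneous_conjg f x y :
  quasi_homomorphism f -> homogeneous f -> f (x ^ y) = f x.
Proof.
move=> [D fD] fH; apply/eqP; rewrite -subr_eq0; apply/eqP.
apply: (@eq0_of_bounded_mulrn _ (D + D)%R) => n.
rewrite -normrMn mulrnBl -!homogeneousX // -conjXg.
(* The elements z * y and y * z ^ y coincide, for z = x ^+ n. *)
have := fD y ((x ^+ n) ^ y); have := fD (x ^+ n) y.
rewrite -conjgC !ler_norml => /andP[? ?] /andP[? ?].
by apply/andP; split; lra.
Qed.

(** On the subgroup generated by x and y, the map z |-> z * z ^ t is
multiplicative and doubles f, so it also doubles the defect. *)
Lemma displaceable_double f x y :
  displaceable -> quasi_homomorphism f -> homogeneous f ->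
  exists X Y,
    (f (X * Y)%g - f X - f Y = (f (x * y)%g - f x - f y) *+ 2)%R.
Proof.
move=> dispG fQ fH; have [t [cxx cxy cyx cyy]] := dispG x y.
have double z : commute z (z ^ t) -> f (z * z ^ t) = (f z *+ 2)%R.
  by move=> cz; rewrite homogeneous_commute // homogeneous_conjg // mulr2n.
exists (x * x ^ t), (y * y ^ t).
have -> : (x * x ^ t) * (y * y ^ t) = (x * y) * (x * y) ^ t.
  by rewrite conjMg -mulgA (mulgA (x ^ t)) -cyx !mulgA.
rewrite !double ?mulrnBl // conjMg; apply: commuteM.
  by apply/commute_sym/commuteM; apply: commute_sym.
by apply/commute_sym/commuteM; apply: commute_sym.
Qed.

Theorem displaceable_additive f :
  displaceable -> quasi_homomorphism f -> homogeneous f ->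
  additive_homomorphism f.
Proof.
move=> dispG fQ fH x y; have [D fD] := fQ.
apply/eqP; rewrite -subr_eq0 opprD addrA; apply/eqP.
have bound k : forall a b, (`|f (a * b)%g - f a - f b| *+ 2 ^ k <= D)%R.
  elim: k => [|k IHk] a b; first exact: fD.
  have [A [B defAB]] := displaceable_double a b dispG fQ fH.
  by have := IHk A B; rewrite defAB normrMn -mulrnA expnS.
apply: (@eq0_of_bounded_mulrn _ D) => n.
apply: le_trans (bound n x y); apply: ler_wpMn2l => //.
exact/ltnW/ltn_expl.
Qed.

End CommutingConjugates.

(** * Shifting sequences that satisfy the braid relations *)

Section BraidRelations.
Variables (G : groupType) (s : nat -> G).
Hypothesis s_far : forall i j, i.+1 < j -> commute (s i) (s j).
Hypothesis s_braid : forall i, s i * s i.+1 * s i = s i.+1 * s i * s i.+1.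

Fixpoint descending m : G :=
  if m is m'.+1 then s m' * descending m' else 1.

Lemma descending_far m j : m < j -> commute (s j) (descending m).
Proof.
elim: m => [|m IHm] mj /=; first exact: commute1.
apply: commuteM; first exact/commute_sym/s_far.
exact/IHm/ltnW.
Qed.

(** In the product, s i moves right past every factor down to
s i.+1 * s i, where the braid relation turns it into s i.+1; the latter
commutes with the remaining factors, whose indices are below i. *)
Lemma descending_conj m i : i.+1 < m -> s i ^ descending m = s i.+1.
Proof.
move=> im; suff swap : s i * descending m = descending m * s i.+1.
  by rewrite conjgE swap mulKg.
elim: m im => // m IHm; rewrite ltnS leq_eqVlt => /predU1P[<-|im] /=.
  by rewrite !mulgA s_braid -!mulgA (descending_far (ltnSn i)).
by rewrite mulgA (s_far im) -!mulgA IHm.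
Qed.

Lemma descendingX_conj m k i :
  i + k < m -> s i ^ (descending m ^+ k) = s (i + k).
Proof.
elim: k => [|k IHk] ikm; first by rewrite conjg1 addn0.
rewrite addnS in ikm *.
by rewrite expgSr conjgM (IHk (ltnW ikm)) descending_conj.
Qed.

End BraidRelations.

(** * The infinite braid group *)

Definition artin (i : nat) : braid_inf :=
  braid_incl (@braid_class i.+2 [:: (ord_max, false)]).

Lemma artinE n (i : 'I_n.-1) :
  braid_incl (braid_class [:: (i, false)]) = artin i.
Proof.
have le_in : i.+2 <= n by case: n i => [|n] [].
rewrite /artin -(braid_incl_stab le_in) stab_class /=.
congr (braid_incl (braid_class [:: (_, _)])); exact: val_inj.
Qed.

Lemma artin_far i j : i.+1 < j -> commute (artin i) (artin j).
Proof.
move=> ij; have ij' : i < j.+1 by rewrite ltnS ltnW // ltnW.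
have -> : artin i = braid_incl (@braid_class j.+2 [:: (Ordinal ij', false)]).
  by rewrite artinE.
rewrite /commute -!braid_inclM !braid_classM.
by congr braid_incl; apply/braid_classP; apply: braid_eq_far.
Qed.

Lemma artin_braid i :
  artin i * artin i.+1 * artin i = artin i.+1 * artin i * artin i.+1.
Proof.
have ii : i < i.+2 by [].
have -> : artin i = braid_incl (@braid_class i.+3 [:: (Ordinal ii, false)]).
  by rewrite artinE.
rewrite -!braid_inclM !braid_classM.
by congr braid_incl; apply/braid_classP; apply: braid_eq_braid.
Qed.

Lemma braid_classV n (i : 'I_n.-1) :
  braid_class [:: (i, true)] = (braid_class [:: (i, false)])^-1.
Proof.
apply: (mulgI (braid_class [:: (i, false)])).
rewrite mulgV braid_classM.
by apply/braid_classP; apply: (braid_eq_cancel i false).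
Qed.

(** A property of braids on n strands inside the infinite braid group may be
checked on generators, whenever it is closed under the group operations. *)
Lemma braid_incl_ind n (P : braid_inf -> Prop) :
  P 1 -> (forall a b, P a -> P b -> P (a * b)) -> (forall a, P a -> P a^-1) ->
  (forall i, i < n.-1 -> P (artin i)) ->
  forall x : braid_group n, P (braid_incl x).
Proof.
move=> P1 PM PV Ps x; rewrite -[x]braid_class_repr.
elim: (repr x) => [|[i b] u IHu]; first by rewrite braid_class1 braid_incl1.
rewrite -cat1s -braid_classM braid_inclM; apply: PM IHu.
case: b; last by rewrite artinE; apply: Ps.
by rewrite braid_classV gmulfV; apply: PV; rewrite /= artinE; apply: Ps.
Qed.

(** The n-fold shift moves the generators of B_n, of indices below n - 1, to
indices at least n.  The index n - 1 is skipped, so every shifted generator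
is far from every original one. *)
Lemma braid_group_displaceable n :
  exists t : braid_inf, forall x y : braid_group n,
    commute (braid_incl x) (braid_incl y ^ t).
Proof.
exists (descending artin (n + n) ^+ n) => x y; set t := _ ^+ n.
have shift i : i < n.-1 -> artin i ^ t = artin (i + n).
  move=> lt_in; apply: (descendingX_conj artin_far artin_braid).
  by rewrite ltn_add2r (leq_trans lt_in) ?leq_pred.
move: x; apply: (@braid_incl_ind n (commute^~ (braid_incl y ^ t)))
  => [|a b ca cb|a ca|i lt_in] /=.
- exact/commute_sym/commute1.
- by apply/commute_sym/commuteM; apply: commute_sym.
- exact/commute_sym/commuteV/commute_sym.
move: y; apply: (@braid_incl_ind n (fun a => commute (artin i) (a ^ t)))
  => [|a b ca cb|a ca|j lt_jn].
- by rewrite conj1g; apply: commute1.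
- by rewrite conjMg; apply: commuteM.
- by rewrite conjVg; apply: commuteV.
rewrite shift //; apply: artin_far.
by rewrite (@leq_trans n) ?leq_addl //; case: (n) lt_in.
Qed.

Lemma braid_inf_displaceable : displaceable braid_inf.
Proof.
move=> a b; have [n [x [y [-> ->]]]] := braid_inf_common2 a b.
by have [t disp] := braid_group_displaceable n; exists t.
Qed.

Theorem theorem3p5 (R : realType) (phi : braid_inf -> R) :
  quasi_homomorphism phi -> homogeneous phi -> additive_homomorphism phi.
Proof. exact/displaceable_additive/braid_inf_displaceable. Qed.
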